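(* Assume that $\mathfrak{g}$ is $\mathfrak{sl}_{r+1}$ or $\mathfrak{sp}_{2r}$, and let $m\in\mathbb{Z}_{>0}$. For some polynomial $\bar Q_m\in\mathbb{C}[X]$ of degree $m-1$ we have $\mathrm{ev}_\rho(\overline{\mathrm{d}p}_{m,k})=\bar Q_m(k)$ for $k=1,\ldots,r$, so that $$\mathrm{ev}_\rho(\overline{\mathrm{d}p}_m)=\frac{1}{m!}\sum_{k=1}^r\bar Q_m(k)\,\varpi_k^\sharp .$$ Moreover $\bar Q_1=1$ if $\mathfrak{g}=\mathfrak{sl}_{r+1}$, and $\bar Q_1=2$ if $\mathfrak{g}=\mathfrak{sp}_{2r}$.
   Context: Work over $\mathbb{C}$; $r$ is the rank of $\mathfrak{g}$. Realizations. (A) $\mathfrak{g}=\mathfrak{sl}_{r+1}$: traceless $(r+1)\times(r+1)$ matrices, $\mathfrak{h}$ the diagonal ones, $\varepsilon_i(\mathrm{diag}(h_1,\ldots,h_{r+1}))=h_i$, positive roots $\varepsilon_i-\varepsilon_j$ ($i<j$), simple roots $\beta_i=\varepsilon_i-\varepsilon_{i+1}$ ($1\le i\le r$), $B_{\mathfrak g}(X,Y)=\mathrm{tr}(XY)$; put $n=r+1$. (C) $\mathfrak{g}=\mathfrak{sp}_{2r}$: $2r\times 2r$ matrices $A$ with $JA+A^tJ=0$, $J=\begin{pmatrix}0&I_r\\-I_r&0\end{pmatrix}$, $\mathfrak{h}$ the diagonal ones, $\varepsilon_i(\mathrm{diag}(h_1,\ldots,h_r,-h_1,\ldots,-h_r))=h_i$,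 positive roots $\varepsilon_i\pm\varepsilon_j$ ($i<j$) and $2\varepsilon_k$, simple roots $\beta_i=\varepsilon_i-\varepsilon_{i+1}$ ($i<r$), $\beta_r=2\varepsilon_r$, $B_{\mathfrak g}(X,Y)=\frac12\mathrm{tr}(XY)$; put $n=2r$. In both cases $\mathfrak{g}=\mathfrak{n}_-\oplus\mathfrak{h}\oplus\mathfrak{n}_+$ is the corresponding triangular decomposition, $\varpi_1,\ldots,\varpi_r$ are the fundamental weights (dual to the simple coroots), $\rho$ is the half-sum of positive roots, and for $x\in\mathfrak{h}^*$, $x^\sharp\in\mathfrak{h}$ is defined by $B_{\mathfrak g}(x^\sharp,y)=x(y)$ for $y\in\mathfrak{h}$. Let $(\pi,\mathbb{C}^n)$ be the standard representation of $\mathfrak{g}$ and $p_m:=\frac{1}{(m+1)!}\,\mathrm{tr}\circ\pi^{m+1}\in\mathbb{C}[\mathfrak{g}]^{\mathfrak g}$, i.e. $p_m(x)=\frac{1}{(m+1)!}\mathrm{tr}(\pi(x)^{m+1})$. Using $B_{\mathfrak g}$ to identify $\mathfrak{g}^*\cong\mathfrak{g}$, view $p_m\in S(\mathfrak{g}^* )\cong S(\mathfrak{g})$. For a basis $(b_k)$ of $\mathfrak{g}$ with dual basis $(b_k^* )$ of $\mathfrak{g}^*\cong\mathfrak{g}$, set $\mathrm{d}p_m=\sum_k\frac{\partial p_m}{\partial b_k^*}\otimes b_k^*\in(S(\mathfrak{g})\otimes\mathfrak{g})^{\mathfrak{g}}$. $\mathrm{Ch}\colon S(\mathfrak{g})\to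 S(\mathfrak{h})$ is the projection with respect to $S(\mathfrak{g})=S(\mathfrak{h})\oplus(\mathfrak{n}_-+\mathfrak{n}_+)S(\mathfrak{g})$, and $\overline{\mathrm{d}p}_m:=(\mathrm{Ch}\otimes1)(\mathrm{d}p_m)$, which lies in $S(\mathfrak{h})\otimes\mathfrak{h}$. The elements $\overline{\mathrm{d}p}_{m,k}\in S(\mathfrak{h})$, $k=1,\ldots,r$, are defined by $\overline{\mathrm{d}p}_m=\frac{1}{m!}\sum_{k=1}^r\overline{\mathrm{d}p}_{m,k}\otimes\varpi_k^\sharp$. The map $\mathrm{ev}_\rho\colon S(\mathfrak{h})\cong\mathbb{C}[\mathfrak{h}^*]\to\mathbb{C}$ is evaluation at $\rho$; applied to an element of $S(\mathfrak{h})\otimes\mathfrak{h}$, $\mathrm{ev}_\rho$ means $\mathrm{ev}_\rho\otimes 1$, with values in $\mathfrak{h}$.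
   Formalization: For sp_{2r} with m even and m ≤ r, p_m = 0, so the values at k = 1,…,r vanish and no polynomial of degree exactly m−1 fits (e.g. sp_4, m = 2); in that case alone the formal statement takes Q̄_m = 0 instead of degree m−1. *)

(* Defs.v *)
From HB Require Import structures.
From mathcomp Require Import all_boot all_order all_algebra.
From mathcomp Require Import mpoly complex reals.

Set Implicit Arguments.
Unset Strict Implicit.
Unset Printing Implicit Defensive.

Import Order.TTheory GRing.Theory Num.Theory.
Local Open Scope ring_scope.

(* A matrix Lie algebra g inside 'M_n has Cartan subalgebra the diagonal
   matrices of g; elements of h^* are linear forms on subvs_of (cartan g). *)
Section Cartan.
Variables (F : fieldType) (n : nat) (g : {vspace 'M[F]_n}).

Definition offdiag (A : 'M[F]_n) : 'M[F]_n :=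
  \matrix_(i, j) (A i j *+ (i != j)).

Fact offdiag_is_linear : linear offdiag.
Proof.
by move=> a A B; apply/matrixP=> i j; rewrite !mxE mulrnDl mulrnAr.
Qed.
HB.instance Definition _ :=
  GRing.isLinear.Build F 'M[F]_n 'M[F]_n _ offdiag offdiag_is_linear.

Definition cartan : {vspace 'M[F]_n} := (g :&: lker (linfun offdiag))%VS.

Lemma mem_cartan A : A \in cartan = (A \in g) && is_diag_mx A.
Proof.
rewrite memv_cap memv_ker lfunE /=; congr (_ && _).
apply/eqP/is_diag_mxP => [/matrixP H i j ij | H].
  by have := H i j; rewrite !mxE neq_ltn -neq_ltn ij mulr1n.
apply/matrixP=> i j; rewrite !mxE; case: (eqVneq i j) => //= ij.
by rewrite mulr1n H.
Qed.

Definition cartan_dual := 'Hom(subvs_of cartan, F^o).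

Definition eps (i : 'I_n) : cartan_dual :=
  linfun (fun y : subvs_of cartan => (vsval y i i : F^o)).

Lemma epsE i y : eps i y = vsval y i i.
Proof.
pose f (z : subvs_of cartan) : F^o := vsval z i i.
have f_lin : linear f by move=> a u v; rewrite /f linearP !mxE.
pose fM := GRing.isLinear.Build F _ _ _ f f_lin.
pose fL : {linear _ -> _} := HB.pack f fM.
exact: (lfunE fL).
Qed.

Definition bracket (A B : 'M[F]_n) : 'M[F]_n := A *m B - B *m A.

Definition root_space (a : cartan_dual) : {vspace 'M[F]_n} :=
  (g :&: \bigcap_(y <- vbasis {:subvs_of cartan})
           lker (linfun (fun A : 'M[F]_n => bracket (vsval y) A - a y *: A)))%VS.

Lemma root_spaceP (a : cartan_dual) (A : 'M[F]_n) :
  reflect (A \in g /\ forall y : subvs_of cartan, bracket (vsval y) A = a y *: A)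
          (A \in root_space a).
Proof.
pose f y (B : 'M[F]_n) := bracket (vsval y) B - a y *: B.
have lf y : linear (f y).
  move=> c u v; rewrite /f /bracket mulmxDl mulmxDr -scalemxAl -scalemxAr.
  rewrite scalerDr scalerA [a y * c]mulrC -scalerA !opprD.
  by rewrite (addrACA (c *: _)) (addrACA (c *: _ - _)) !scalerBr.
have fE y B : (B \in lker (linfun (f y))) = (f y B == 0).
  pose fM := GRing.isLinear.Build F _ _ _ (f y) (lf y).
  pose fL : {linear _ -> _} := HB.pack (f y) fM.
  by rewrite memv_ker (lfunE fL).
have capE (s : seq (subvs_of cartan)) :
    (A \in (\bigcap_(y <- s) lker (linfun (f y)))%VS) = all (fun y => f y A == 0) s.
  elim: s => [|y s IH]; first by rewrite big_nil memvf.
  by rewrite big_cons memv_cap fE IH.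
rewrite /root_space memv_cap capE.
apply: (iffP andP) => -[Ag H]; split=> //; last first.
  by apply/allP => y _; rewrite /f H subrr.
move=> y; apply/eqP; rewrite -subr_eq0 -/(f y A); apply/eqP.
have gD c u v : f (c *: u + v) A = c *: f u A + f v A.
  rewrite /f /bracket !linearP /= mulmxDl -scalemxAl scalerDl !scalerBr opprD.
  by rewrite scalerN (addrACA (c *: _)) (addrACA (c *: _ - _)) -scalerA.
rewrite (coord_vbasis (memvf y)).
apply: (big_ind (fun u => f u A = 0)) => [|u v fu fv|i _].
- by rewrite /f /bracket !linear0 mul0mx scale0r subr0 addr0.
- by have := gD 1 u v; rewrite !scale1r fu fv addr0.
- have := gD (coord (vbasis {:subvs_of cartan}) i y)
             (vbasis {:subvs_of cartan})`_i 0.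
  rewrite addr0 => ->; move/allP: H => /(_ (vbasis {:subvs_of cartan})`_i).
  rewrite mem_nth ?size_tuple // => /(_ isT) /eqP ->.
  by rewrite scaler0 add0r /f /bracket !linear0 mul0mx scale0r subr0 addr0.
Qed.

End Cartan.

Record realization (F : fieldType) (r : nat) := Realization {
  rep_dim : nat;
  lie_alg : {vspace 'M[F]_rep_dim};
  form_coef : F;
  pos_roots : seq (cartan_dual lie_alg);
  simple_root : 'I_r -> cartan_dual lie_alg
}.

Section Realizations.
Variables (F : fieldType) (r : nat).

Definition sl_alg : {vspace 'M[F]_r.+1} :=
  lker (linfun (fun A : 'M[F]_r.+1 => (\tr A : F^o))).

Lemma mem_sl A : (A \in sl_alg) = (\tr A == 0).
Proof. by rewrite memv_ker (lfunE (@mxtrace F r.+1 : {linear _ -> F^o})). Qed.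

Definition sl_realization : realization F r :=
  let e := @eps F r.+1 sl_alg in
  {| form_coef := 1;
     pos_roots :=
       [seq e p.1 - e p.2 | p : 'I_r.+1 * 'I_r.+1 <- enum {: 'I_r.+1 * 'I_r.+1}
                          & (p.1 < p.2)%N];
     simple_root := fun k => e (widen_ord (leqnSn r) k) - e (lift ord0 k) |}.

Definition sp_J : 'M[F]_(r + r) := block_mx 0 1%:M (- 1%:M) 0.

Definition sp_alg : {vspace 'M[F]_(r + r)} :=
  lker (linfun (fun A : 'M[F]_(r + r) => sp_J *m A + A^T *m sp_J)).

Lemma mem_sp A : (A \in sp_alg) = (sp_J *m A + A^T *m sp_J == 0).
Proof.
pose f (B : 'M[F]_(r + r)) := sp_J *m B + B^T *m sp_J.
have f_lin : linear f.
  move=> a u v; rewrite /f !linearP /= mulmxDl -scalemxAl scalerDr.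
  by rewrite addrACA.
pose fM := GRing.isLinear.Build F _ _ _ f f_lin.
pose fL : {linear _ -> _} := HB.pack f fM.
by rewrite memv_ker (lfunE fL).
Qed.

(* [insub k.+1] is [Some j] with j = k + 1 when k + 1 < r, and [None] for the
   last index. *)
Definition sp_realization : realization F r :=
  let e (i : 'I_r) := @eps F (r + r) sp_alg (lshift r i) in
  {| form_coef := 2%:R^-1;
     pos_roots := [seq e p.1 - e p.2 | p : 'I_r * 'I_r <- enum {: 'I_r * 'I_r}
                                     & (p.1 < p.2)%N]
               ++ [seq e p.1 + e p.2 | p : 'I_r * 'I_r <- enum {: 'I_r * 'I_r}
                                     & (p.1 < p.2)%N]
               ++ [seq e k *+ 2 | k <- enum 'I_r];
     simple_root := fun k => if insub k.+1 is Some j then e k - e j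
                             else e k *+ 2 |}.

End Realizations.

Variant lie_type := SL | SP.

Definition is_SP (t : lie_type) : bool := if t is SP then true else false.

Definition realization_of (F : fieldType) (r : nat) (t : lie_type) :
    realization F r :=
  match t with SL => sl_realization F r | SP => sp_realization F r end.

(* S-linear tensors: an element of S (x) 'M_n is a matrix over S. *)
Definition tens (F : fieldType) (d n : nat) (p : {mpoly F[d]}) (A : 'M[F]_n) :
    'M[{mpoly F[d]}]_n :=
  p *: map_mx (@mpolyC d F) A.

Section LieTheory.
Variables (F : fieldType) (r : nat) (X : realization F r).

Notation n := (rep_dim X).
Notation g := (lie_alg X).
Notation h := (cartan g).
Notation hT := (subvs_of h).

Definition form (A B : 'M[F]_n) : F := form_coef X * \tr (A *m B).

Definition flat : 'Hom(hT, cartan_dual g) :=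
  linfun (fun y : hT =>
    (linfun (fun z : hT => (form (vsval y) (vsval z) : F^o)) : cartan_dual g)).

Lemma flatE y z : flat y z = form (vsval y) (vsval z).
Proof.
pose f (u v : hT) : F^o := form (vsval u) (vsval v).
have lf u : linear (f u).
  move=> c v w; rewrite /f /form !linearP /=.
  by rewrite mulrDr mulrCA.
pose fM u := GRing.isLinear.Build F _ _ _ (f u) (lf u).
pose fL u : {linear _ -> _} := HB.pack (f u) (fM u).
have fE u v : linfun (f u) v = f u v by exact: (lfunE (fL u)).
pose k u : cartan_dual g := linfun (f u).
have lk : linear k.
  move=> c u v; apply/lfunP=> w; rewrite add_lfunE scale_lfunE !fE /f /form.
  by rewrite linearP /= mulmxDl -scalemxAl !linearP /= mulrDr mulrCA.
pose kM := GRing.isLinear.Build F _ _ _ k lk.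
pose kL : {linear _ -> _} := HB.pack k kM.
by rewrite /flat (lfunE kL) /= fE.
Qed.

(* In characteristic 0, [flat] is bijective on the realizations above, so its
   inverse is x |-> x^#. *)
Definition sharp : cartan_dual g -> hT := (flat^-1)%VF.

Definition coroot (a : cartan_dual g) : hT :=
  (2%:R / form (vsval (sharp a)) (vsval (sharp a))) *: sharp a.

Definition simple_coroots : r.-tuple hT :=
  [tuple coroot (simple_root X k) | k < r].

Definition fund_weight (k : 'I_r) : cartan_dual g :=
  linfun (fun y : hT => (coord simple_coroots k y : F^o)).

Definition rho : cartan_dual g := 2%:R^-1 *: \sum_(a <- pos_roots X) a.

Definition nil_plus : {vspace 'M[F]_n} :=
  (\sum_(a <- pos_roots X) root_space a)%VS.

Definition nil_minus : {vspace 'M[F]_n} :=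
  (\sum_(a <- pos_roots X) root_space (- a))%VS.

(* S(h) is the polynomial algebra on the basis [vbasis {:hT}] of h. *)
Definition Sh := {mpoly F[\dim {:hT}]}.

Definition Sh_inj (y : hT) : Sh := \sum_i coord (vbasis {:hT}) i y *: 'X_i.

Definition eval_Sh (x : cartan_dual g) (p : Sh) : F :=
  p.@[fun i => x (vbasis {:hT})`_i].

(* S(g) is the polynomial algebra on a basis (b_k^* ) of g: the variable 'X_k
   stands for b_k^*, seen both in g^* and in g by means of the form. *)
Definition Sg := {mpoly F[\dim g]}.

Section Bases.
Variables b bs : (\dim g).-tuple 'M[F]_n.

Definition dual_bases : Prop :=
  [/\ basis_of g b, basis_of g bs &
      forall j k : 'I_(\dim g), form (tnth b j) (tnth bs k) = (j == k)%:R].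

(* The generic element of g: \sum_k b_k^* (x) b_k. *)
Definition generic_mx : 'M[Sg]_n := \sum_k tens 'X_k (tnth b k).

Definition p_inv (m : nat) : Sg :=
  (m.+1)`!%:R^-1 *: \tr (generic_mx ^+ m.+1).

Lemma p_invE m (A : 'M[F]_n) : dual_bases -> A \in g ->
  (p_inv m).@[fun k => form (tnth bs k) A] = (m.+1)`!%:R^-1 * \tr (A ^+ m.+1).
Proof.
case=> b_basis _ b_dual Ag; set v := fun k => _.
have formC B C : form B C = form C B by rewrite /form mxtrace_mulC.
have vE k : v k = coord b k A.
  rewrite /v {1}(coord_basis b_basis Ag) /form mulmx_sumr linear_sum /= mulr_sumr.
  rewrite (bigD1 k) //= big1 ?addr0 => [|j jk].
    rewrite -scalemxAr linearZ /= mulrCA -/(form _ _) formC -tnth_nth b_dual.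
    by rewrite eqxx mulr1.
  rewrite -scalemxAr linearZ /= mulrCA -/(form _ _) formC -tnth_nth b_dual.
  by rewrite (negbTE jk) mulr0.
have genE : map_mx (meval v) generic_mx = A.
  rewrite [RHS](coord_basis b_basis Ag) raddf_sum /=; apply: eq_bigr => k _.
  apply/matrixP=> i j; rewrite !mxE rmorphM /= mevalXU mevalC vE.
  by rewrite -tnth_nth.
have powE k (B : 'M[Sg]_n) : map_mx (meval v) (B ^+ k) = map_mx (meval v) B ^+ k.
  by elim: k => [|k IH]; rewrite ?expr0 ?map_mx1 // !exprS map_mxM IH.
by rewrite mevalZ -trace_map_mx powE genE.
Qed.

Definition dp_inv (m : nat) : 'M[Sg]_n :=
  \sum_k tens (p_inv m)^`M(k) (tnth bs k).

Definition Sg_inj (A : 'M[F]_n) : Sg := \sum_k coord bs k A *: 'X_k.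

(* The morphism of algebras extending the projection of g onto h along
   n_- + n_+; it is the identity on S(h) and its kernel is (n_- + n_+)S(g), so
   it is the projection for S(g) = S(h) (+) (n_- + n_+)S(g). *)
Definition Ch (p : Sg) : Sh :=
  comp_mpoly
    [tuple Sh_inj (vsproj h (daddv_pi h (nil_minus + nil_plus) (tnth bs k)))
      | k < \dim g] p.

Lemma Ch_inj (A : 'M[F]_n) : basis_of g bs -> A \in g ->
  Ch (Sg_inj A) = Sh_inj (vsproj h (daddv_pi h (nil_minus + nil_plus) A)).
Proof.
move=> bs_basis Ag; pose pr B := vsproj h (daddv_pi h (nil_minus + nil_plus) B).
have ShL (I : Type) (s : seq I) (c : I -> F) (y : I -> hT) :
    Sh_inj (\sum_(i <- s) c i *: y i) = \sum_(i <- s) c i *: Sh_inj (y i).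
  rewrite (eq_bigr _ (fun i _ => scaler_sumr _ _ _ _)) exchange_big /=.
  apply: eq_bigr => j _; rewrite linear_sum scaler_suml; apply: eq_bigr => i _.
  by rewrite linearZ scalerA.
rewrite -/(pr A) [in RHS](coord_basis bs_basis Ag).
have -> : pr (\sum_k coord bs k A *: bs`_k) = \sum_k coord bs k A *: pr bs`_k.
  by rewrite /pr !linear_sum; apply: eq_bigr => k _; rewrite !linearZ.
rewrite ShL /Ch /Sg_inj raddf_sum; apply: eq_bigr => k _ /=.
by rewrite comp_mpolyZ comp_mpolyXU nth_mktuple /pr (tnth_nth 0 bs).
Qed.

Definition dpbar (m : nat) : 'M[Sh]_n := map_mx Ch (dp_inv m).

Definition is_dpbar_coords (m : nat) (q : {ffun 'I_r -> Sh}) : Prop :=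
  dpbar m
  = (m`!%:R^-1)%:MP *: \sum_k tens (q k) (vsval (sharp (fund_weight k))).

End Bases.
End LieTheory.

(* Main.v *)
Require Import Defs.
From mathcomp Require Import all_boot all_order all_algebra.
From mathcomp Require Import mpoly complex reals.
From HB Require Import structures.
From mathcomp Require Import ring.

(* Let G be the generic element of g. By cyclicity of the trace, the derivative of
   p_m along b_k is tr(G^m b_k) / m!, and Ch(G) is the generic diagonal matrix H,
   so dpbar_m is the trace-dual of H^m / m! in S(h) (x) h. As the simple coroots
   are dual to the fundamental weights, dpbar_{m,k} is the sum of the H_i^m weighted
   by the diagonal entries of the k-th simple coroot. At rho, H becomes
   diag(rho^#), whose entries (the first r of them for sp) decrease in steps of 1,
   so the weighted sum is (a - k)^m - (a - 1 - k)^m with a = r/2 + 1 for sl, and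
   1 - (-1)^m times the same expression with a = r + 1 for sp. *)

Import Order.TTheory GRing.Theory Num.Theory.
Local Open Scope ring_scope.

(** * Derivations applied to traces of matrix powers *)

Section Derivation.
Set Implicit Arguments.
Unset Strict Implicit.
Variables (S : comNzRingType) (D : {additive S -> S}) (n : nat).
Hypothesis DM : forall p q, D (p * q) = D p * q + p * D q.
Implicit Types A B : 'M[S]_n.

Lemma derivation_mulmx A B :
  map_mx D (A *m B) = map_mx D A *m B + A *m map_mx D B.
Proof.
apply/matrixP=> i j; rewrite !mxE raddf_sum -big_split; apply: eq_bigr => l _.
by rewrite !mxE DM.
Qed.

(** The Leibniz rule yields [m + 1] terms, and cyclicity of the trace makes them all equal. *)
Lemma derivation_trace_exp A m :
  D (\tr (A ^+ m.+1)) = \tr (A ^+ m *m map_mx D A) *+ m.+1.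
Proof.
have D1 : D 1 = 0.
  by apply: (@addrI _ (D 1)); rewrite addr0 -{3}[1]mulr1 DM mulr1 mul1r.
(* The spare factor [A ^+ u] collects the copies of [A] that the induction on [t] rotates around the
   trace. At [t = u = 0] the truncated predecessor is harmless, as its term is taken zero times. *)
have aux t u : \tr (map_mx D (A ^+ t) *m A ^+ u)
    = \tr (A ^+ (t + u).-1 *m map_mx D A) *+ t.
  elim: t u => [|t IHt] u.
    suff -> : map_mx D (A ^+ 0) = 0 by rewrite mul0mx mxtrace0 mulr0n.
    by apply/matrixP=> i j; rewrite !mxE raddfMn D1 mul0rn.
  rewrite exprS derivation_mulmx mulmxDl mxtraceD -!mulmxA mulrS.
  congr (_ + _); first by rewrite mxtrace_mulC mulmxE -exprD.
  by rewrite mxtrace_mulC -mulmxA mulmxE -exprSr -mulmxE IHt addnS addSn.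
have /= := aux m.+1 0%N; rewrite addn0 expr0 mulmx1 => <-.
by rewrite raddf_sum; apply: eq_bigr => i _; rewrite mxE.
Qed.

End Derivation.

Lemma diag_mx_exp (S : comNzRingType) n (v : 'rV[S]_n) m :
  diag_mx v ^+ m = diag_mx (\row_i v 0 i ^+ m).
Proof.
elim: m => [|m IHm].
  by apply/matrixP=> i j; rewrite expr0 !mxE.
rewrite exprS IHm -mulmxE mulmx_diag; congr diag_mx.
by apply/rowP=> i; rewrite !mxE exprS.
Qed.

(** * The trace form on [g] and on its Cartan subalgebra *)

Section DualBasis.
Set Implicit Arguments.
Unset Strict Implicit.
Variables (F : numFieldType) (r : nat) (X : realization F r).
Notation n := (rep_dim X).
Notation g := (lie_alg X).
Notation h := (cartan g).
Notation hT := (subvs_of h).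
Notation form := (@Defs.form F r X).
Implicit Types A B C : 'M[F]_n.

Lemma form_sym A B : form A B = form B A.
Proof. by rewrite /Defs.form mxtrace_mulC. Qed.

Lemma form_sumr B (I : Type) (s : seq I) (c : I -> F) (A : I -> 'M[F]_n) :
  form B (\sum_(i <- s) c i *: A i) = \sum_(i <- s) c i * form B (A i).
Proof.
rewrite /Defs.form mulmx_sumr raddf_sum mulr_sumr; apply: eq_bigr => i _ /=.
by rewrite -scalemxAr linearZ mulrCA.
Qed.

Lemma form_suml B (I : Type) (s : seq I) (c : I -> F) (A : I -> 'M[F]_n) :
  form (\sum_(i <- s) c i *: A i) B = \sum_(i <- s) c i * form (A i) B.
Proof. by rewrite form_sym form_sumr; under eq_bigr do rewrite form_sym. Qed.

Lemma form_scaler a A B : form A (a *: B) = a * form A B.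
Proof. by rewrite /Defs.form -scalemxAr linearZ /= mulrCA. Qed.

Lemma form_subr A B C : form A (B - C) = form A B - form A C.
Proof. by rewrite /Defs.form mulmxBr raddfB mulrBr. Qed.

Lemma form_bracket A B C : form (bracket A B) C = form A (bracket B C).
Proof.
rewrite /Defs.form /bracket mulmxBl mulmxBr !raddfB /= !mulmxA.
by rewrite -[B *m A *m C]mulmxA (mxtrace_mulC B).
Qed.

Lemma mem_hT (y : hT) : vsval y \in g.
Proof. by have := subvsP y; rewrite mem_cartan => /andP[]. Qed.

Lemma hT_diag (y : hT) i j : i != j -> vsval y i j = 0.
Proof.
have := subvsP y; rewrite mem_cartan => /andP[_ /is_diag_mxP yd] ij.
by rewrite yd.
Qed.

Lemma hTE (y : hT) : vsval y = diag_mx (\row_i vsval y i i).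
Proof.
apply/matrixP=> i j; rewrite !mxE; case: eqVneq => [->|/hT_diag ->] //.
Qed.

Lemma form_hT (y : hT) A : form (vsval y) A = form_coef X * \sum_i vsval y i i * A i i.
Proof.
rewrite /Defs.form {1}hTE mul_diag_mx; congr (_ * _); apply: eq_bigr => i _.
by rewrite !mxE.
Qed.

Lemma bracket_hTr B (y : hT) i j :
  bracket B (vsval y) i j = (vsval y j j - vsval y i i) * B i j.
Proof.
by rewrite /bracket {1 2}hTE mul_diag_mx mul_mx_diag !mxE mulrBl [B i j * _]mulrC.
Qed.

Section Fixed.
Variables b bs : (\dim g).-tuple 'M[F]_n.
Hypothesis hb : dual_bases b bs.

Lemma form_b_sum (c : 'I_(\dim g) -> F) j :
  form (tnth b j) (\sum_k c k *: tnth bs k) = c j.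
Proof.
have [_ _ bd] := hb; rewrite form_sumr (bigD1 j) //= bd eqxx mulr1.
by rewrite big1 ?addr0 // => i ij; rewrite bd eq_sym (negbTE ij) mulr0.
Qed.

Lemma bs_expansion A : A \in g -> A = \sum_k form (tnth b k) A *: tnth bs k.
Proof.
have [_ bsb _] := hb => /(coord_basis bsb) AE.
have formE k : form (tnth b k) A = coord bs k A.
  by rewrite {1}AE; under eq_bigr do rewrite -tnth_nth; rewrite form_b_sum.
by rewrite {1}AE; apply: eq_bigr => k _; rewrite formE -tnth_nth.
Qed.

(** Nondegeneracy of the form on [g] is read off from the existence of dual bases. *)
Lemma form_inj A B : A \in g -> B \in g ->
  (forall C, C \in g -> form C A = form C B) -> A = B.
Proof.
have [bb _ _] := hb => Ag Bg AB; rewrite (bs_expansion Ag) (bs_expansion Bg).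
by apply: eq_bigr => k _; rewrite AB // (basis_mem bb) // mem_tnth.
Qed.

(* The element of [g] representing the matrix entry [B |-> B i j]. *)
Definition entry i j : 'M[F]_n := \sum_k tnth b k i j *: tnth bs k.

Lemma mem_entry i j : entry i j \in g.
Proof.
have [_ bsb _] := hb; apply: rpred_sum => k _; apply: rpredZ.
by rewrite (basis_mem bsb) // mem_tnth.
Qed.

Lemma form_entry B i j : B \in g -> form B (entry i j) = B i j.
Proof.
have [bb _ _] := hb => /(coord_basis bb) ->.
rewrite form_suml summxE; apply: eq_bigr => k _.
by rewrite -tnth_nth form_b_sum !mxE.
Qed.

Hypothesis g_bracket : forall A B, A \in g -> B \in g -> bracket A B \in g.

(** By invariance of the form, [y] acts on [entry i j] through its action on the matrix entry
    represented. Hence the swapped indices: the weight is that of the elementary matrix in position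
    [(j, i)]. *)
Lemma bracket_entry (y : hT) i j :
  bracket (vsval y) (entry i j) = (vsval y j j - vsval y i i) *: entry i j.
Proof.
apply: form_inj => [||C Cg]; first by rewrite g_bracket ?mem_hT ?mem_entry.
  by rewrite rpredZ ?mem_entry.
rewrite -form_bracket form_scaler !form_entry ?bracket_hTr //.
by rewrite g_bracket ?mem_hT.
Qed.

Lemma entry_root_space i j : entry i j \in root_space (eps g j - eps g i).
Proof.
apply/root_spaceP; split=> [|y]; first exact: mem_entry.
by rewrite bracket_entry add_lfunE opp_lfunE !epsE.
Qed.

(** The diagonal of rho^#, an identification made by [rhoE] further on. Its distinct entries make
    [diag_mx d] regular: only diagonal matrices commute with it. *)
Variable d : 'rV[F]_n.
Hypothesis d_g : diag_mx d \in g.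
Hypothesis d_inj : injective (d 0).

Lemma diag_cartan : diag_mx d \in h.
Proof. by rewrite mem_cartan d_g diag_mx_is_diag. Qed.

Lemma eps_diag i : eps g i (vsproj h (diag_mx d)) = d 0 i.
Proof. by rewrite epsE vsprojK ?diag_cartan // mxE eqxx mulr1n. Qed.

(** [entry i i] has weight zero, so it commutes with the regular element [diag_mx d]. *)
Lemma entry_diag_cartan i : entry i i \in h.
Proof.
rewrite mem_cartan mem_entry; apply/is_diag_mxP=> k l kl.
have := bracket_entry (vsproj h (diag_mx d)) i i.
rewrite subrr scale0r => /matrixP/(_ k l); rewrite vsprojK ?diag_cartan //.
rewrite /bracket mul_diag_mx mul_mx_diag !mxE [_ * d 0 l]mulrC -mulrBl.
move=> /eqP; rewrite mulf_eq0 subr_eq0 (inj_eq d_inj) => /orP[/eqP kl'|/eqP //].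
by rewrite kl' eqxx in kl.
Qed.

Definition diag_entry i : hT := vsproj h (entry i i).

Lemma diag_entryE i : vsval (diag_entry i) = entry i i.
Proof. by rewrite vsprojK ?entry_diag_cartan. Qed.

Lemma form_diag_entry (y : hT) i : form (vsval y) (vsval (diag_entry i)) = vsval y i i.
Proof. by rewrite diag_entryE form_entry ?mem_hT. Qed.

(** Paired with [y], a matrix contributes only its diagonal entries, which the [diag_entry i]
    represent. These span the Cartan subalgebra but may be linearly dependent. *)
Lemma hT_entry_sum (y : hT) :
  y = form_coef X *: \sum_i vsval y i i *: diag_entry i.
Proof.
apply: subvs_inj; apply: form_inj; rewrite ?mem_hT // => C Cg.
rewrite form_sym form_hT linearZ /= form_scaler linear_sum /= form_sumr; congr (_ * _).
by apply: eq_bigr => i _; rewrite diag_entryE form_entry.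
Qed.

Lemma flat_inj (y z : hT) : flat X y = flat X z -> y = z.
Proof.
move=> yz; rewrite [y]hT_entry_sum [z]hT_entry_sum; congr (_ *: _).
by apply: eq_bigr => i _; rewrite -!form_diag_entry -!flatE yz.
Qed.

(** The inverse [flat^-1] is a right inverse only on the image of [flat], so a preimage of [x] is
    required. It copies [hT_entry_sum], with the values of [x] on the spanning family as
    coefficients. *)
Lemma sharpK : cancel (@sharp F r X) (flat X).
Proof.
move=> x; apply: limg_lfunVK; pose c i : F := x (diag_entry i).
suff -> : x = flat X (form_coef X *: \sum_i c i *: diag_entry i).
  exact: memv_img (memvf _).
apply/lfunP=> y; rewrite flatE [y in LHS]hT_entry_sum linearZ linear_sum /=.
rewrite form_sym form_scaler [vsval (\sum_(_ < _) _)]linear_sum /= form_sumr.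
congr (_ * _).
by apply: eq_bigr => i _; rewrite linearZ /= form_diag_entry mulrC.
Qed.

Lemma form_sharp (x : cartan_dual g) (y : hT) : form (vsval (sharp x)) (vsval y) = x y.
Proof. by rewrite -flatE sharpK. Qed.

Lemma sharp_eq (x : cartan_dual g) (z : hT) :
  (forall y : hT, x y = form (vsval z) (vsval y)) -> sharp x = z.
Proof.
by move=> xz; apply: flat_inj; apply/lfunP=> y; rewrite sharpK flatE.
Qed.

(** * Root spaces and the triangular decomposition *)

Hypothesis pos_rootsP : forall a, a \in pos_roots X ->
  exists i j, i != j /\ a = eps g i - eps g j.
Hypothesis pos_roots_total : forall i j, i != j ->
  eps g i - eps g j \in pos_roots X \/ eps g j - eps g i \in pos_roots X.

Notation nil := (nil_minus X + nil_plus X)%VS.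

(** The bracket with [diag_mx d] has zero diagonal, while the root takes the nonzero value
    [d_i - d_j] at this element. *)
Lemma root_space_offdiag i j : i != j ->
  (root_space (eps g i - eps g j) <= limg (linfun (@offdiag F n)))%VS.
Proof.
move=> ij; apply/subvP=> A /root_spaceP[_ /(_ (vsproj h (diag_mx d)))].
rewrite add_lfunE opp_lfunE !eps_diag vsprojK ?diag_cartan // => A_root.
suff -> : A = linfun (@offdiag F n) A by exact: memv_img (memvf _).
apply/matrixP=> k l; rewrite lfunE !mxE; case: eqVneq => // <- /=.
have /matrixP/(_ k k)/eqP := A_root; rewrite /bracket mul_diag_mx mul_mx_diag !mxE.
rewrite [A k k * _]mulrC subrr eq_sym mulf_eq0 subr_eq0 (inj_eq d_inj).
by rewrite (negbTE ij) => /eqP.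
Qed.

Lemma nil_offdiag : (nil <= limg (linfun (@offdiag F n)))%VS.
Proof.
rewrite subv_add; apply/andP; split; rewrite /nil_minus /nil_plus big_seq;
  apply: (big_ind (fun U => (U <= limg (linfun (@offdiag F n)))%VS)) => [|U V UV VV|a].
- exact: sub0v.
- by rewrite subv_add UV.
- case/pos_rootsP=> i [j [ij ->]]; rewrite opprB.
  by rewrite root_space_offdiag // eq_sym.
- exact: sub0v.
- by rewrite subv_add UV.
- by case/pos_rootsP=> i [j [ij ->]]; rewrite root_space_offdiag.
Qed.

(** This directness makes [daddv_pi], on which [Ch] rests, the identity on the Cartan subalgebra and
    zero on the root spaces. *)
Lemma cartan_nil0 : (h :&: nil)%VS = 0%VS.
Proof.
apply/eqP; rewrite -subv0; apply/subvP=> A; rewrite memv_cap => /andP[].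
rewrite mem_cartan => /andP[_ /is_diag_mxP Ad].
move=> /(subvP nil_offdiag) /memv_imgP[B _]; rewrite lfunE /= => AE.
rewrite memv0; apply/eqP/matrixP=> i j; rewrite [RHS]mxE.
case: (eqVneq i j) => [->|/Ad //]; by rewrite AE mxE eqxx.
Qed.

Lemma root_space_nil a : a \in pos_roots X ->
  (root_space a <= nil)%VS /\ (root_space (- a) <= nil)%VS.
Proof.
move=> a_pos; split.
  apply: subv_trans (addvSr _ _).
  by rewrite /nil_plus (big_rem _ a_pos) addvSl.
apply: subv_trans (addvSl _ _).
by rewrite /nil_minus (big_rem _ a_pos) addvSl.
Qed.

Lemma entry_nil i j : i != j -> entry i j \in nil.
Proof.
move=> ij; have := entry_root_space i j.
have [/root_space_nil[_]|/root_space_nil[]] := pos_roots_total ij; last first.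
  by move=> /subvP s _ /s.
by rewrite opprB => /subvP s /s.
Qed.

Lemma daddv_pi_nil A : A \in nil -> daddv_pi h nil A = 0.
Proof.
move=> An; have nil_h0 : (nil :&: h)%VS = 0%VS by rewrite capvC cartan_nil0.
have := daddv_pi_add cartan_nil0 (subvP (addvSr h nil) _ An).
by rewrite (daddv_pi_id nil_h0 An) => /(canRL (addrK _)); rewrite subrr.
Qed.

(** * The projection [Ch] and the image of the differential *)

Lemma Sh_inj_lin : linear (@Sh_inj F r X).
Proof.
move=> a y z; rewrite /Sh_inj scaler_sumr -big_split; apply: eq_bigr => i _.
by rewrite linearP scalerDl scalerA.
Qed.

Lemma Ch_entry i j :
  Ch bs (Sg_inj bs (entry i j))
  = if i == j then Sh_inj (diag_entry i) else 0.
Proof.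
have [_ bsb _] := hb; rewrite (Ch_inj bsb) ?mem_entry //.
case: eqVneq => [<-|/entry_nil/daddv_pi_nil ->].
  by rewrite daddv_pi_id ?cartan_nil0 ?entry_diag_cartan.
by rewrite linear0 -(subrr (Sh_inj 0)) -scaleN1r addrC -Sh_inj_lin scaler0 addr0
  /Sh_inj big1 // => k _; rewrite linear0 scale0r.
Qed.

(** The coordinates of [entry i j] along [bs] are the entries of the [b_k] by construction, and
    these are the coefficients of the variables in the generic matrix. *)
Lemma generic_mxE i j : generic_mx b i j = Sg_inj bs (entry i j).
Proof.
have [_ bsb _] := hb.
rewrite /generic_mx summxE /Sg_inj; apply: eq_bigr => k _; rewrite !mxE.
suff -> : coord bs k (entry i j) = tnth b k i j by rewrite mulrC mul_mpolyC.
rewrite /entry linear_sum (bigD1 k) //= linearZ /= (tnth_nth 0 bs).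
rewrite coord_free ?(basis_free bsb) //.
rewrite eqxx mulr1 big1 ?addr0 // => l lk; rewrite linearZ /= (tnth_nth 0 bs).
by rewrite coord_free ?(basis_free bsb) // (negbTE lk) mulr0.
Qed.

HB.instance Definition _ :=
  GRing.RMorphism.copy (@Ch F r X bs)
    (comp_mpoly
       [tuple Sh_inj (vsproj h (daddv_pi h (nil_minus X + nil_plus X)
                                  (tnth bs k))) | k < \dim g]).

Lemma Ch_C c : Ch bs c%:MP = c%:MP.
Proof. exact: comp_mpolyC. Qed.

Lemma Ch_generic_mx :
  map_mx (Ch bs) (generic_mx b) = diag_mx (\row_i Sh_inj (diag_entry i)).
Proof.
apply/matrixP=> i j; rewrite !mxE generic_mxE Ch_entry.
by case: eqVneq => //= _; rewrite mulr0n.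
Qed.

Lemma mderiv_generic_mx k :
  map_mx (mderiv k) (generic_mx b) = map_mx (@mpolyC _ F) (tnth b k).
Proof.
apply/matrixP=> i j; rewrite !mxE /generic_mx summxE raddf_sum /= (bigD1 k) //=.
rewrite big1 ?addr0 => [|l lk]; rewrite !mxE mderivM mderivC mulr0 addr0 mderivX mnm1E.
  by rewrite eqxx scale1r -[X in (X - _)%MM]add0m addmK mpolyX0 mul1r.
by rewrite (negbTE lk) scale0r mul0r.
Qed.

(** The factor [m + 1] from differentiating the trace turns [(m + 1)!] into [m!]. *)
Lemma mderiv_p_inv m k : (p_inv b m)^`M(k)
  = m`!%:R^-1 *: \tr (generic_mx b ^+ m *m map_mx (@mpolyC _ F) (tnth b k)).
Proof.
rewrite /p_inv mderivZ (derivation_trace_exp (@mderivM _ _ k)) mderiv_generic_mx.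
rewrite -scaler_nat scalerA factS natrM invfM mulrAC mulVf ?mul1r //.
by rewrite pnatr_eq0.
Qed.

(** Once [Ch] has made the generic matrix diagonal, the trace against [b_k] involves only the
    diagonal of [b_k]. Exchanging the sums, the entries [(l, l)] of the [b_k] times the [bs_k] add
    up to [entry l l]. *)
Lemma dpbarE m : dpbar b bs m =
  (m`!%:R^-1)%:MP *: \sum_i tens (Sh_inj (diag_entry i) ^+ m) (entry i i).
Proof.
apply/matrixP=> i j; rewrite !mxE /dp_inv !summxE rmorph_sum mulr_sumr /=.
under eq_bigr => k _.
  rewrite !mxE rmorphM /= Ch_C mderiv_p_inv -mul_mpolyC rmorphM /= Ch_C.
  rewrite -trace_map_mx map_mxM rmorphXn /= Ch_generic_mx diag_mx_exp.
  rewrite mul_diag_mx /mxtrace -mulrA mulr_suml mulr_sumr.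
  over.
rewrite exchange_big /=; apply: eq_bigr => l _; rewrite !mxE /entry summxE.
rewrite raddf_sum mulr_sumr mulr_sumr; apply: eq_bigr => k _.
by rewrite !mxE Ch_C /= mpolyCM -mulrA.
Qed.

Lemma eval_Sh_inj (x : cartan_dual g) (y : hT) : eval_Sh x (Sh_inj y) = x y.
Proof.
rewrite /eval_Sh /Sh_inj raddf_sum [y in RHS](coord_vbasis (memvf y)) linear_sum.
by apply: eq_bigr => i _; rewrite /= mevalZ mevalXU linearZ.
Qed.

(** * Evaluation at [rho], simple coroots and fundamental weights *)

Hypothesis rhoE : forall y : hT, rho X y = form (diag_mx d) (vsval y).

Lemma eval_rho_diag_entry i : eval_Sh (rho X) (Sh_inj (diag_entry i)) = d 0 i.
Proof.
by rewrite eval_Sh_inj rhoE diag_entryE form_entry // mxE eqxx mulr1n.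
Qed.

(** In both types the fundamental weights are such partial sums of the [eps i], see [fund_weightE].
    Indices start at 0, so [j + 1] entries are summed. *)
Definition diag_psum (j : 'I_r) (y : hT) : F :=
  \sum_(i < n | (i <= j)%N) vsval y i i.

Variable C : 'I_r -> hT.
Hypothesis corootE : forall k, coroot (simple_root X k) = C k.
Hypothesis psum_coroot : forall j k : 'I_r,
  diag_psum j (C k) = (j == k)%:R.
Hypothesis psum_inj : forall y : hT, (forall j, diag_psum j y = 0) -> y = 0.

Lemma diag_psumB j : {morph diag_psum j : y z / y - z}.
Proof.
by move=> y z; rewrite /diag_psum -sumrB; apply: eq_bigr => i _; rewrite !mxE.
Qed.

Lemma psum_lin_comb j (c : 'I_r -> F) :
  diag_psum j (\sum_k c k *: C k) = c j.
Proof.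
transitivity (\sum_k c k * diag_psum j (C k)).
  rewrite /diag_psum linear_sum.
  under eq_bigr do rewrite summxE.
  rewrite exchange_big /=; apply: eq_bigr => k _; rewrite mulr_sumr.
  by apply: eq_bigr => i _; rewrite mxE.
rewrite (bigD1 j) //= psum_coroot eqxx mulr1 big1 ?addr0 // => i ij.
by rewrite psum_coroot eq_sym (negbTE ij) mulr0.
Qed.

Lemma coroot_expansion (y : hT) :
  y = \sum_k diag_psum k y *: C k.
Proof.
apply/eqP; rewrite -subr_eq0; apply/eqP/psum_inj => j.
by rewrite diag_psumB psum_lin_comb subrr.
Qed.

(** [coord] computes coordinates only along a free family. Duality with the partial sums gives
    freeness, and [coroot_expansion] then gives the coordinates. *)
Lemma fund_weightE k (y : hT) : fund_weight X k y = diag_psum k y.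
Proof.
have coroots_nth (i : 'I_r) : (simple_coroots X)`_i = C i.
  by rewrite -tnth_nth tnth_mktuple corootE.
have coroots_free : free (simple_coroots X).
  apply/freeP=> c c0 i; rewrite -(psum_lin_comb i c).
  under eq_bigr do rewrite -coroots_nth.
  by rewrite c0 /diag_psum big1 // => l _; rewrite linear0 mxE.
pose f : {linear hT -> F^o} := coord (simple_coroots X) k : {scalar hT}.
rewrite /fund_weight (lfunE f) /=.
rewrite [y in LHS]coroot_expansion; under eq_bigr do rewrite -coroots_nth.
by rewrite coord_sum_free.
Qed.

(** For the form, the elements [sharp (fund_weight X k)] are the basis dual to the simple
    coroots. *)
Lemma fund_weight_expansion (y : hT) :
  y = \sum_k form (vsval y) (vsval (C k)) *: sharp (fund_weight X k).
Proof.
apply: flat_inj; apply/lfunP=> z; rewrite !flatE linear_sum /=.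
rewrite form_suml [z in LHS]coroot_expansion linear_sum /= form_sumr.
by apply: eq_bigr => k _; rewrite form_sharp fund_weightE mulrC.
Qed.

(** Pairing with the [j]-th coroot isolates one coefficient of the tensor; this yields uniqueness of
    the coordinates. *)
Lemma tens_fund_weight_coord (q : 'I_r -> Sh X) j :
  (form_coef X)%:MP * (\sum_i (vsval (C j) i i)%:MP
     * (\sum_k tens (q k) (vsval (sharp (fund_weight X k)))) i i) = q j.
Proof.
transitivity (\sum_k (form (vsval (C j)) (vsval (sharp (fund_weight X k))))%:MP * q k).
  under eq_bigr do rewrite summxE mulr_sumr.
  rewrite exchange_big mulr_sumr /=; apply: eq_bigr => k _.
  rewrite form_hT mpolyCM raddf_sum -mulrA mulr_suml; congr (_ * _).
  by apply: eq_bigr => i _; rewrite !mxE /= mpolyCM mulrCA mulrC.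
rewrite (bigD1 j) //= form_sym form_sharp fund_weightE psum_coroot eqxx mul1r.
rewrite big1 ?addr0 // => k kj; rewrite form_sym form_sharp fund_weightE psum_coroot.
by rewrite (negbTE kj) mul0r.
Qed.

Theorem dpbar_coords m :
  unique (is_dpbar_coords b bs m)
    [ffun k => \sum_i vsval (C k) i i *: Sh_inj (diag_entry i) ^+ m].
Proof.
set q0 := finfun _.
have coords0 : is_dpbar_coords b bs m q0.
  rewrite /is_dpbar_coords dpbarE; congr (_ *: _).
  apply/matrixP=> i j; rewrite !summxE.
  under eq_bigr => l _.
    (* The coefficient of [entry l l] on the [k]-th fundamental weight is its pairing with [C k],
       that is, the [l]-th diagonal entry of [C k]. *)
    rewrite !mxE -diag_entryE [X in vsval X]fund_weight_expansion.
    rewrite linear_sum summxE raddf_sum mulr_sumr.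
    over.
  rewrite exchange_big /=; apply: eq_bigr => k _; rewrite !mxE ffunE mulr_suml.
  apply: eq_bigr => l _; rewrite mxE form_sym form_diag_entry mpolyCM.
  by rewrite -mul_mpolyC mulrCA mulrA.
split=> // q q_coords; apply/ffunP=> j.
rewrite -(tens_fund_weight_coord q0) -(tens_fund_weight_coord q).
have scale_inj : injective (fun M : 'M[Sh X]_n => (m`!%:R^-1)%:MP *: M).
  apply: (can_inj (g := fun M => (m`!%:R)%:MP *: M)) => M.
  by rewrite scalerA -mpolyCM mulfV ?mpolyC1 ?scale1r // pnatr_eq0 -lt0n fact_gt0.
have eqs := scale_inj _ _ (etrans (esym coords0) q_coords).
by rewrite eqs.
Qed.

(** What is left to each type is a scalar identity on power sums of [d]. The argument [k.+1]
    converts indices from 0 into the numbering 1, ..., r. *)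
Theorem dpbar_coords_rho m (Q : {poly F}) :
    (forall k : 'I_r, \sum_i vsval (C k) i i * d 0 i ^+ m = Q.[k.+1%:R]) ->
  exists2 q : {ffun 'I_r -> Sh X}, unique (is_dpbar_coords b bs m) q &
    (forall k : 'I_r, eval_Sh (rho X) (q k) = Q.[k.+1%:R]) /\
    map_mx (eval_Sh (rho X)) (dpbar b bs m)
    = m`!%:R^-1 *: \sum_(k < r) Q.[k.+1%:R] *: vsval (sharp (fund_weight X k)).
Proof.
move=> QE; exists [ffun k => \sum_i vsval (C k) i i *: Sh_inj (diag_entry i) ^+ m].
  exact: dpbar_coords.
have q_rho (k : 'I_r) : eval_Sh (rho X)
    ([ffun k => \sum_i vsval (C k) i i *: Sh_inj (diag_entry i) ^+ m] k)
    = Q.[k.+1%:R].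
  rewrite ffunE -QE /eval_Sh raddf_sum; apply: eq_bigr => i _ /=.
  by rewrite mevalZ rmorphXn /= -/(eval_Sh (rho X) _) eval_rho_diag_entry.
split=> //; have [-> _] := dpbar_coords m.
apply/matrixP=> i j; rewrite !mxE /eval_Sh rmorphM /= mevalC; congr (_ * _).
rewrite !summxE raddf_sum; apply: eq_bigr => k _ /=.
by rewrite !mxE rmorphM /= mevalC -/(eval_Sh (rho X) _) q_rho.
Qed.

End Fixed.
End DualBasis.

(** * Difference polynomials and sums over pairs of indices *)

Section Sums.
Set Implicit Arguments.
Unset Strict Implicit.
Variable F : numFieldType.

(** This is [(Y + 1)^m - Y^m] at [Y = a - 1 - X], written with the top terms already cancelled so
    that its size can be read off. *)
Definition pow_diff (a : F) m : {poly F} :=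
  (\poly_(i < m) 'C(m, i)%:R) \Po ((a - 1)%:P - 'X).

Lemma horner_pow_diff a m x :
  (pow_diff a m).[x] = (a - x) ^+ m - (a - 1 - x) ^+ m.
Proof.
rewrite /pow_diff horner_comp horner_poly !hornerE.
have -> : a - x = (a - 1 - x) + 1 by rewrite addrAC subrK.
rewrite exprD1n big_ord_recr /= binn addrK.
by apply: eq_bigr => i _; rewrite mulr_natl.
Qed.

(** The outer polynomial has leading coefficient [m], nonzero in characteristic 0, and the inner one
    has degree 1. *)
Lemma size_pow_diff a m : size (pow_diff a m) = m.
Proof.
rewrite /pow_diff size_comp_poly2; last by rewrite -opprB size_polyN size_XsubC.
case: m => [|m]; first by rewrite poly_def big_ord0 size_poly0.
by rewrite size_poly_eq //= binSn pnatr_eq0.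
Qed.

Lemma pow_diff1 a : pow_diff a 1 = 1.
Proof. by rewrite /pow_diff poly_def big_ord1 expr0 scale1r comp_polyC. Qed.

Lemma sum_delta n (P : pred 'I_n) (a : 'I_n) :
  \sum_(i < n | P i) (i == a)%:R = (P a)%:R :> F.
Proof.
case: (boolP (P a)) => Pa.
  rewrite (bigD1 a) //= eqxx big1 ?addr0 // => i /andP[_ /negbTE -> //].
rewrite big1 // => i; case: eqVneq => // -> Pa'; by rewrite Pa' in Pa.
Qed.

Lemma sum_deltaM n (a : 'I_n) (f : 'I_n -> F) :
  \sum_(i < n) (i == a)%:R * f i = f a.
Proof.
rewrite (bigD1 a) //= eqxx mul1r big1 ?addr0 // => i /negbTE ->.
by rewrite mul0r.
Qed.

Lemma sum_ord_lt n k (x : F) : (k <= n)%N -> \sum_(i < n | (i < k)%N) x = x *+ k.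
Proof. by move=> kn; rewrite -(big_ord_widen n (fun=> x) kn) sumr_const card_ord. Qed.

Lemma sum_lt_fst n (f : 'I_n -> F) :
  \sum_(p : 'I_n * 'I_n | (p.1 < p.2)%N) f p.1 = \sum_i f i *+ (n - i.+1).
Proof.
rewrite -(pair_big_dep xpredT (fun i j : 'I_n => (i < j)%N) (fun i _ => f i)) /=.
apply: eq_bigr => i _; rewrite mulrnBr // -[in RHS](sum_ord_lt (f i) (ltn_ord i)).
have -> : f i *+ n = \sum_(j < n) f i by rewrite sumr_const card_ord.
rewrite [X in X - _](bigID (fun j : 'I_n => (j < i.+1)%N)) /=.
by rewrite addrAC subrr add0r; apply: eq_bigl => j; rewrite ltnNge.
Qed.

Lemma sum_lt_snd n (f : 'I_n -> F) :
  \sum_(p : 'I_n * 'I_n | (p.1 < p.2)%N) f p.2 = \sum_i f i *+ i.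
Proof.
rewrite -(pair_big_dep xpredT (fun i j : 'I_n => (i < j)%N) (fun _ j => f j)) /=.
rewrite (exchange_big_dep xpredT) //=; apply: eq_bigr => i _.
by rewrite sum_ord_lt // ltnW.
Qed.

(** The index [i] occurs [r - i] times as the smaller one and [i] times as the larger one. These are
    the coordinates of rho for sl. *)
Lemma half_sum_lt_sub r (f : 'I_r.+1 -> F) :
  2%:R^-1 * (\sum_(p : 'I_r.+1 * 'I_r.+1 | (p.1 < p.2)%N) (f p.1 - f p.2))
  = \sum_(i < r.+1) (r%:R / 2%:R - i%:R) * f i.
Proof.
rewrite sumrB sum_lt_fst sum_lt_snd -sumrB mulr_sumr; apply: eq_bigr => i _.
rewrite subSS -[f i *+ (_ - _)]mulr_natl -[f i *+ i]mulr_natl.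
rewrite natrB; last by rewrite -ltnS.
by field.
Qed.

Lemma psum_eq0 n r (f : 'I_n -> F) :
    (forall j : 'I_r, \sum_(i < n | (i <= j)%N) f i = 0) ->
  forall i : 'I_n, (i < r)%N -> f i = 0.
Proof.
move=> f0 i; have [k] := ubnP (i : nat); elim: k i => // k IHk i ik ir.
rewrite -[RHS](f0 (Ordinal ir)) (bigD1 i) //= big1 ?addr0 // => l /andP[li l_i].
have ltli : (l < i)%N by rewrite ltn_neqAle li andbT.
by apply: IHk; [apply: leq_trans ltli _ | apply: ltn_trans ir].
Qed.

(** The product of the [X - k] has size [r + 1], and a power of [X] pads it to size [m]. It serves
    even [m] in the symplectic case. *)
Lemma exists_vanishing_poly r m : (r < m)%N ->
  exists2 Q : {poly F}, size Q = m & forall k : 'I_r, Q.[k.+1%:R] = 0.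
Proof.
move=> rm; pose P : {poly F} := \prod_(k < r) ('X - (k.+1%:R)%:P).
have P_monic : P \is monic by apply: monic_prod => k _; apply: monicXsubC.
exists (P * 'X^(m - r.+1)) => [|k].
  rewrite size_mulXn ?monic_neq0 // /P size_prod_XsubC.
  rewrite -[index_enum _]enumT size_enum_ord.
  by rewrite subnK.
by rewrite hornerM /P horner_prod (bigD1 k) //= !hornerE subrr !mul0r.
Qed.

End Sums.

(** * The case of sl *)

Section SpecialLinear.
Set Implicit Arguments.
Unset Strict Implicit.
Variables (F : numFieldType) (r : nat).
Notation X := (sl_realization F r).
Notation hT := (subvs_of (cartan (lie_alg X))).
Variables b bs : (\dim (lie_alg X)).-tuple 'M[F]_(rep_dim X).
Hypothesis hb : dual_bases b bs.

Lemma sl_bracket (A B : 'M[F]_r.+1) :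
  A \in sl_alg F r -> B \in sl_alg F r -> bracket A B \in sl_alg F r.
Proof. by rewrite !mem_sl /bracket raddfB /= mxtrace_mulC subrr. Qed.

Definition sl_rho : 'rV[F]_r.+1 := \row_i (r%:R / 2%:R - i%:R).

Lemma diag_sl_rho : diag_mx sl_rho \in sl_alg F r.
Proof.
(* In twice the trace, the entries at [i] and [r - i] cancel. *)
rewrite mem_sl mxtrace_diag -[_ == 0](@mulrn_eq0 _ _ 2) mulr2n /=.
rewrite {2}(reindex_inj rev_ord_inj) -big_split big1 //= => i _.
rewrite !mxE /= subSS natrB; last by rewrite -ltnS.
by field.
Qed.

Lemma sl_rho_inj : injective (sl_rho 0).
Proof.
move=> i j; rewrite !mxE => /addrI/oppr_inj/eqP.
by rewrite eqr_nat => /eqP/val_inj.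
Qed.

Lemma sl_pos_rootsP a : a \in pos_roots X ->
  exists i j : 'I_r.+1, i != j /\ a = eps (lie_alg X) i - eps (lie_alg X) j.
Proof.
case/mapP=> -[i j]; rewrite mem_filter /= => /andP[ij _] ->.
by exists i, j; split=> //; rewrite neq_ltn ij.
Qed.

Lemma sl_pos_roots_total (i j : 'I_r.+1) : i != j ->
  eps (lie_alg X) i - eps (lie_alg X) j \in pos_roots X \/
  eps (lie_alg X) j - eps (lie_alg X) i \in pos_roots X.
Proof.
rewrite neq_ltn => /orP[ij|ji]; [left | right]; apply/mapP.
  by exists (i, j); rewrite // mem_filter /= ij mem_enum.
by exists (j, i); rewrite // mem_filter /= ji mem_enum.
Qed.

Lemma sl_rhoE (y : hT) : rho X y = Defs.form (X := X) (diag_mx sl_rho) (vsval y).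
Proof.
rewrite /rho /Defs.form mul_diag_mx mul1r scale_lfunE big_map big_filter big_enum_cond.
rewrite sum_lfunE /=.
under eq_bigr do rewrite add_lfunE opp_lfunE !epsE.
rewrite -[_ *: _]/(2%:R^-1 * _) (half_sum_lt_sub (fun i => vsval y i i)).
by apply: eq_bigr => i _; rewrite !mxE.
Qed.

Definition sl_coroot (k : 'I_r) : hT :=
  vsproj _ (diag_mx (delta_mx 0 (widen_ord (leqnSn r) k) - delta_mx 0 (lift ord0 k))).

Lemma sl_corootE k : vsval (sl_coroot k)
  = diag_mx (delta_mx 0 (widen_ord (leqnSn r) k) - delta_mx 0 (lift ord0 k)).
Proof.
rewrite vsprojK // mem_cartan diag_mx_is_diag andbT mem_sl mxtrace_diag.
under eq_bigr do rewrite !mxE /=.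
by rewrite sumrB !sum_delta subrr.
Qed.

Lemma sl_coroot_diag k i : vsval (sl_coroot k) i i
  = (i == widen_ord (leqnSn r) k)%:R - (i == lift ord0 k)%:R.
Proof. by rewrite sl_corootE !mxE !eqxx. Qed.

Lemma form_sl_coroot k (y : hT) : Defs.form (vsval (sl_coroot k)) (vsval y)
  = vsval y (widen_ord (leqnSn r) k) (widen_ord (leqnSn r) k)
    - vsval y (lift ord0 k) (lift ord0 k).
Proof.
rewrite form_hT mul1r; under eq_bigr do rewrite sl_coroot_diag mulrBl.
by rewrite sumrB !(sum_deltaM _ (fun i => vsval y i i)).
Qed.

(** Simple roots have square length 2, so each coroot is the [sharp] of its root. *)
Lemma coroot_sl k : coroot (simple_root X k) = sl_coroot k.
Proof.
have sharpE : sharp (simple_root X k) = sl_coroot k.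
  apply: (sharp_eq hb sl_bracket diag_sl_rho sl_rho_inj) => y.
  by rewrite form_sl_coroot add_lfunE opp_lfunE !epsE.
have kk1 : (widen_ord (leqnSn r) k == lift ord0 k) = false.
  by apply/negbTE; rewrite neq_ltn /= /bump ltnSn.
rewrite /coroot sharpE form_sl_coroot !sl_coroot_diag !eqxx kk1.
rewrite [lift ord0 k == _]eq_sym kk1.
by rewrite subr0 sub0r opprK -[1 + 1]/(2%:R) divff ?scale1r // pnatr_eq0.
Qed.

Lemma psum_sl_coroot j k : diag_psum j (sl_coroot k) = (j == k)%:R.
Proof.
rewrite /diag_psum; under eq_bigr do rewrite sl_coroot_diag.
rewrite sumrB !sum_delta /= /bump /= add1n leq_eqVlt eq_sym -val_eqE /=.
by case: ltngtP => _; rewrite ?subrr ?subr0.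
Qed.

(** The [r] partial sums determine all diagonal entries but the last, which the zero trace
    supplies. *)
Lemma sl_psum_inj (y : hT) : (forall j, diag_psum j y = 0) -> y = 0.
Proof.
move=> /psum_eq0 y0; have := mem_hT y; rewrite mem_sl /mxtrace big_ord_recr /=.
rewrite big1 ?add0r => [/eqP ymax|i _]; last first.
  exact: (y0 (widen_ord (leqnSn r) i) (ltn_ord i)).
apply: subvs_inj; rewrite (hTE (X := X) y); apply/matrixP=> i j; rewrite !mxE.
case: (unliftP ord_max i) => [i' ->|->]; last by rewrite ymax mul0rn.
by rewrite y0 ?mul0rn // lift_max.
Qed.

Lemma sl_coroot_pow_sum k m :
  \sum_i vsval (sl_coroot k) i i * sl_rho 0 i ^+ m
  = (pow_diff (r%:R / 2%:R + 1) m).[k.+1%:R].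
Proof.
under eq_bigr do rewrite sl_coroot_diag mulrBl.
rewrite sumrB !(sum_deltaM _ (fun i => sl_rho 0 i ^+ m)) horner_pow_diff !mxE /=.
(* The summand 1 in [r/2 + 1] absorbs the shift of indices: [r/2 - k = (r/2 + 1) - (k + 1)]. *)
by rewrite /bump add1n -natr1; congr (_ ^+ _ - _ ^+ _); ring.
Qed.

Theorem dpbar_coords_sl m (Q := pow_diff (r%:R / 2%:R + 1) m) :
  exists2 q : {ffun 'I_r -> Sh X}, unique (is_dpbar_coords b bs m) q &
    (forall k : 'I_r, eval_Sh (rho X) (q k) = Q.[k.+1%:R]) /\
    map_mx (eval_Sh (rho X)) (dpbar b bs m)
    = m`!%:R^-1 *: \sum_(k < r) Q.[k.+1%:R] *: vsval (sharp (fund_weight X k)).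
Proof.
apply: (dpbar_coords_rho hb sl_bracket diag_sl_rho sl_rho_inj sl_pos_rootsP
  sl_pos_roots_total sl_rhoE coroot_sl psum_sl_coroot sl_psum_inj) => k.
exact: sl_coroot_pow_sum.
Qed.

End SpecialLinear.

(** * The case of sp *)

Section Symplectic.
Set Implicit Arguments.
Unset Strict Implicit.
Variables (F : numFieldType) (r : nat).
Notation X := (sp_realization F r).
Notation hT := (subvs_of (cartan (lie_alg X))).
Notation e i := (eps (lie_alg X) i).
Variables b bs : (\dim (lie_alg X)).-tuple 'M[F]_(rep_dim X).
Hypothesis hb : dual_bases b bs.

Lemma sp_bracket (A B : 'M[F]_(r + r)) :
  A \in sp_alg F r -> B \in sp_alg F r -> bracket A B \in sp_alg F r.
Proof.
rewrite !mem_sp !addr_eq0 => /eqP JA /eqP JB; rewrite /bracket mulmxBr !mulmxA.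
rewrite JA JB raddfB /= mulmxBl !trmx_mul -!mulmxA !mulNmx -!mulmxA JA JB.
by rewrite !mulmxN !opprK opprB.
Qed.

Lemma diag_sp (u v : 'rV[F]_r) :
  (diag_mx (row_mx u v) \in sp_alg F r) = (u + v == 0).
Proof.
rewrite mem_sp /sp_J diag_mx_row tr_block_mx !tr_diag_mx !trmx0 !mulmx_block.
rewrite !mul0mx !mulmx0 !mul1mx !mulNmx !mulmxN !mul1mx !mulmx1 !addr0 !add0r.
rewrite add_block_mx !addr0 -opprD -!raddfD /= [v + u]addrC.
apply/eqP/eqP => [|->]; last by rewrite raddf0 oppr0 block_mx0.
move=> /matrixP uv; apply/rowP=> i; have := uv (lshift r i) (rshift r i).
by rewrite block_mxEur !mxE eqxx.
Qed.

Lemma sp_cartan_rshift (y : hT) i :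
  vsval y (rshift r i) (rshift r i) = - vsval y (lshift r i) (lshift r i).
Proof.
pose w : 'rV[F]_(r + r) := \row_k vsval y k k.
have : diag_mx (row_mx (lsubmx w) (rsubmx w)) \in sp_alg F r.
  by rewrite hsubmxK -(hTE (X := X) y) (mem_hT y).
by rewrite diag_sp addrC addr_eq0 => /eqP/rowP/(_ i); rewrite !mxE.
Qed.

(** Thanks to this, the roots [eps_i + eps_j] and [2 eps_i] are also differences of two [eps], as
    the common argument requires. *)
Lemma eps_rshift i : e (rshift r i) = - e (lshift r i).
Proof. by apply/lfunP=> y; rewrite opp_lfunE !epsE sp_cartan_rshift. Qed.

Definition sp_rho : 'rV[F]_(r + r) :=
  let u := \row_(i < r) (r%:R - i%:R) in row_mx u (- u).

Lemma diag_sp_rho : diag_mx sp_rho \in sp_alg F r.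
Proof. by rewrite diag_sp subrr. Qed.

Lemma sp_rho_lshift i : sp_rho 0 (lshift r i) = r%:R - i%:R.
Proof. by rewrite row_mxEl mxE. Qed.

Lemma sp_rho_rshift i : sp_rho 0 (rshift r i) = - (r%:R - i%:R).
Proof. by rewrite row_mxEr !mxE. Qed.

(** The first [r] entries are positive and distinct, and the others are their opposites. *)
Lemma sp_rho_inj : injective (sp_rho 0).
Proof.
have sub_inj (i j : 'I_r) : r%:R - i%:R = r%:R - j%:R :> F -> i = j.
  by move=> /addrI/oppr_inj/eqP; rewrite eqr_nat => /eqP/val_inj.
have sub_gt0 (i : 'I_r) : 0 < r%:R - i%:R :> F by rewrite subr_gt0 ltr_nat.
have sub_opp (i j : 'I_r) : r%:R - i%:R <> - (r%:R - j%:R) :> F.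
  by move/eqP; rewrite -addr_eq0 gt_eqF // addr_gt0 ?sub_gt0.
move=> i j; rewrite -(splitK i) -(splitK j).
case: (split i) (split j) => [i'|i'] [j'|j'] /=;
  rewrite ?sp_rho_lshift ?sp_rho_rshift.
- by move/sub_inj->.
- by move/sub_opp.
- by move/esym/sub_opp.
- by move/oppr_inj/sub_inj->.
Qed.

Lemma sp_pos_rootsP a : a \in pos_roots X ->
  exists i j : 'I_(r + r), i != j /\ a = e i - e j.
Proof.
rewrite !mem_cat => /or3P[] /mapP.
- move=> [[i j]]; rewrite mem_filter /= => /andP[ij _] ->.
  by exists (lshift r i), (lshift r j); rewrite eq_lshift neq_ltn ij.
- move=> [[i j]]; rewrite mem_filter /= => /andP[ij _] ->.
  by exists (lshift r i), (rshift r j); rewrite eq_lrshift eps_rshift opprK.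
- move=> [i _ ->]; exists (lshift r i), (rshift r i).
  by rewrite eq_lrshift eps_rshift opprK mulr2n.
Qed.

Lemma sp_pos_root_sub (i j : 'I_r) : (i < j)%N ->
  e (lshift r i) - e (lshift r j) \in pos_roots X.
Proof.
move=> ij; rewrite !mem_cat; apply/or3P/Or31/mapP.
by exists (i, j); rewrite // mem_filter /= ij mem_enum.
Qed.

Lemma sp_pos_root_add (i j : 'I_r) :
  e (lshift r i) + e (lshift r j) \in pos_roots X.
Proof.
wlog ij : i j / (i <= j)%N => [hw|].
  by case: (leqP i j) => [|/ltnW] ij; [|rewrite addrC]; apply: hw.
rewrite !mem_cat; apply/or3P; move: ij; rewrite leq_eqVlt => /orP[/eqP/val_inj <-|ij].
  by apply/Or33/mapP; exists i; rewrite ?mem_enum ?mulr2n.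
by apply/Or32/mapP; exists (i, j); rewrite // mem_filter /= ij mem_enum.
Qed.

Lemma sp_pos_roots_total (i j : 'I_(r + r)) : i != j ->
  e i - e j \in pos_roots X \/ e j - e i \in pos_roots X.
Proof.
rewrite -(splitK i) -(splitK j).
case: (split i) (split j) => [i'|i'] [j'|j'] /=; rewrite ?eps_rshift ?opprK.
- rewrite eq_lshift neq_ltn => /orP[]; last by right; apply: sp_pos_root_sub.
  by left; apply: sp_pos_root_sub.
- by left; apply: sp_pos_root_add.
- by right; apply: sp_pos_root_add.
- rewrite eq_rshift neq_ltn => /orP[ij|ij].
    by right; rewrite addrC; apply: sp_pos_root_sub.
  by left; rewrite addrC; apply: sp_pos_root_sub.
Qed.

(** Both halves of the diagonal contribute equally, which cancels the coefficient 1/2 of the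
    form. *)
Lemma form_sp (y z : hT) : Defs.form (vsval y) (vsval z)
  = \sum_(i < r) vsval y (lshift r i) (lshift r i) * vsval z (lshift r i) (lshift r i).
Proof.
rewrite form_hT /= big_split_ord /=.
under [X in _ + X]eq_bigr do rewrite !sp_cartan_rshift mulrNN.
by rewrite -mulr2n -[X in _ * X = _]mulr_natl mulKf // pnatr_eq0.
Qed.

Lemma sp_rhoE (y : hT) : rho X y = Defs.form (X := X) (diag_mx sp_rho) (vsval y).
Proof.
have D_h : diag_mx sp_rho \in cartan (lie_alg X).
  by rewrite mem_cartan diag_sp_rho diag_mx_is_diag.
rewrite -(vsprojK D_h) form_sp (vsprojK D_h) /rho scale_lfunE !big_cat /=.
rewrite !big_map !big_filter !big_enum_cond /= !add_lfunE !sum_lfunE.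
(* For [i < j] the roots [eps_i - eps_j] and [eps_i + eps_j] add up to [2 eps_i]. Together with the
   long root, [eps_i] collects the coefficient [2 (r - i)]. *)
rewrite addrA -big_split /=.
under eq_bigr do rewrite !add_lfunE opp_lfunE addrACA addNr addr0 -mulr2n epsE.
under [X in _ + X]eq_bigr do rewrite mulr2n add_lfunE -mulr2n epsE.
rewrite -[_ *: _]/(2%:R^-1 * _).
rewrite (sum_lt_fst (fun i : 'I_r => vsval y (lshift r i) (lshift r i) *+ 2)).
rewrite -big_split mulr_sumr; apply: eq_bigr => i _ /=.
rewrite mxE eqxx mulr1n sp_rho_lshift -mulrSr -subSn // subSS -mulrnA mulnC mulrnA.
rewrite -[X in _ * X]mulr_natl mulKf ?pnatr_eq0 // -natrB ?mulr_natl //.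
by rewrite ltnW.
Qed.

(** This is [eps_i^#], and also the coroot of [2 eps_i]. *)
Definition sp_coweight (i : 'I_r) : hT :=
  vsproj _ (diag_mx (row_mx (delta_mx 0 i) (- delta_mx 0 i))).

Lemma sp_coweight_lshift i k :
  vsval (sp_coweight i) (lshift r k) (lshift r k) = (k == i)%:R.
Proof.
rewrite vsprojK; first by rewrite mxE eqxx row_mxEl mxE mulr1n.
by rewrite mem_cartan diag_sp subrr eqxx diag_mx_is_diag.
Qed.

Lemma form_sp_coweight i (y : hT) : Defs.form (vsval (sp_coweight i)) (vsval y)
  = vsval y (lshift r i) (lshift r i).
Proof.
rewrite form_sp; under eq_bigr do rewrite sp_coweight_lshift.
by rewrite (sum_deltaM _ (fun k => vsval y (lshift r k) (lshift r k))).
Qed.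

Definition sp_coroot (k : 'I_r) : hT :=
  if insub k.+1 is Some j then sp_coweight k - sp_coweight j else sp_coweight k.

(** Short simple roots have square length 2, so the coroot is the [sharp]. The long one has square
    length 4, so its coroot is half of its [sharp]. *)
Lemma coroot_sp k : coroot (simple_root X k) = sp_coroot k.
Proof.
rewrite /sp_coroot /=; case: insubP => [j _ jk|_] /=.
  have formD (y : hT) : Defs.form (vsval (sp_coweight k - sp_coweight j)) (vsval y)
      = vsval y (lshift r k) (lshift r k) - vsval y (lshift r j) (lshift r j).
    by rewrite form_sym form_subr !(form_sym (vsval y)) !form_sp_coweight.
  have sharpE : sharp (e (lshift r k) - e (lshift r j)) = sp_coweight k - sp_coweight j.
    apply: (sharp_eq hb sp_bracket diag_sp_rho sp_rho_inj) => y.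
    by rewrite add_lfunE opp_lfunE !epsE formD.
  have kj : (k == j) = false by rewrite -val_eqE /= jk ltn_eqF.
  rewrite /coroot sharpE formD !mxE !sp_coweight_lshift !eqxx kj [j == k]eq_sym kj.
  by rewrite subr0 sub0r opprK -[1 + 1]/(2%:R) divff ?scale1r // pnatr_eq0.
have sharpE : sharp (e (lshift r k) *+ 2) = 2%:R *: sp_coweight k.
  apply: (sharp_eq hb sp_bracket diag_sp_rho sp_rho_inj) => y.
  rewrite mulr2n add_lfunE epsE form_sym form_scaler form_sym form_sp_coweight.
  by rewrite mulr_natl mulr2n.
rewrite /coroot sharpE /= form_scaler form_sym form_scaler form_sp_coweight.
rewrite sp_coweight_lshift eqxx.
by rewrite scalerA mulr1 invfM mulrA divff ?mul1r ?mulVf ?scale1r // pnatr_eq0.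
Qed.

Lemma psum_sp j (y : hT) :
  diag_psum j y = \sum_(i < r | (i <= j)%N) vsval y (lshift r i) (lshift r i).
Proof.
rewrite /diag_psum big_split_ord /= [X in _ + X]big_pred0 ?addr0 // => i.
by rewrite leqNgt ltn_addr.
Qed.

Lemma psum_sp_coroot j k : diag_psum j (sp_coroot k) = (j == k)%:R.
Proof.
have psumD i : diag_psum j (sp_coweight i) = (i <= j)%:R.
  by rewrite psum_sp; under eq_bigr do rewrite sp_coweight_lshift; rewrite sum_delta.
rewrite /sp_coroot -val_eqE; case: insubP => [l _ lk|] /=.
  by rewrite diag_psumB !psumD lk; case: ltngtP => _; rewrite ?subrr ?subr0.
(* Here [k] is the largest index, so [k <= j] already forces [j = k]. *)
rewrite -leqNgt psumD => rk; congr (_%:R); congr (nat_of_bool _).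
by rewrite eqn_leq -[(j <= k)%N]ltnS (leq_trans (ltn_ord j) rk).
Qed.

Lemma sp_psum_inj (y : hT) : (forall j, diag_psum j y = 0) -> y = 0.
Proof.
move=> y0; have {}y0 i : vsval y (lshift r i) (lshift r i) = 0.
  by apply: (psum_eq0 (f := fun i => vsval y (lshift r i) (lshift r i))) (ltn_ord i)
    => j; rewrite -psum_sp.
apply: subvs_inj; rewrite (hTE (X := X) y); apply/matrixP=> i j; rewrite !mxE.
case: eqVneq => //= _; rewrite mulr1n -(splitK i).
by case: (split i) => i' /=; rewrite ?sp_cartan_rshift y0 ?oppr0.
Qed.

Lemma sp_coroot_pow_sum k m : (0 < m)%N ->
  \sum_i vsval (sp_coroot k) i i * sp_rho 0 i ^+ m
  = ((1 - (-1) ^+ m) *: pow_diff (r%:R + 1) m).[k.+1%:R].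
Proof.
move=> m_gt0; rewrite big_split_ord /=.
(* In the second half both the weight and the base of the power change sign, which gives [-(-1)^m]
   times the first half. *)
under [X in _ + X]eq_bigr do
  rewrite sp_cartan_rshift sp_rho_rshift exprNn mulNr mulrCA -mulrN -sp_rho_lshift.
rewrite -mulr_sumr sumrN mulrN -mulNr -[X in X + _]mul1r -mulrDl hornerZ; congr (_ * _).
have D_pow i : \sum_(l < r) vsval (sp_coweight i) (lshift r l) (lshift r l)
    * sp_rho 0 (lshift r l) ^+ m = (r%:R - i%:R) ^+ m.
  under eq_bigr do rewrite sp_coweight_lshift.
  by rewrite (sum_deltaM _ (fun l => sp_rho 0 (lshift r l) ^+ m)) sp_rho_lshift.
rewrite horner_pow_diff addrK /sp_coroot.
have -> : r%:R + 1 - k.+1%:R = r%:R - k%:R :> F by rewrite -natr1; ring.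
case: insubP => [j _ jk|]; last first.
  (* The last coroot has no second term. The polynomial agrees because its second power is [0 ^+ m],
     which vanishes for [m > 0]. *)
  rewrite -leqNgt D_pow => rk.
  have rkE : r%:R = k.+1%:R :> F by apply/eqP; rewrite eqr_nat eqn_leq rk ltn_ord.
  by rewrite rkE subrr expr0n gtn_eqF // subr0.
have valB i : vsval (sp_coweight k - sp_coweight j) i i
    = vsval (sp_coweight k) i i - vsval (sp_coweight j) i i by rewrite !mxE.
under eq_bigr do rewrite valB mulrBl.
by rewrite sumrB !D_pow jk.
Qed.

(* For even [m] the coordinates vanish at rho. When [m <= r], [0] is then the
   only interpolating polynomial of degree less than [r]. *)
Lemma sp_interpolation m : (0 < m)%N ->
  exists Q : {poly F},
    [/\ if ~~ odd m && (m <= r)%N then Q = 0 else size Q = m,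
        m = 1%N -> Q = 2%:R%:P &
        forall k : 'I_r, Q.[k.+1%:R]
          = ((1 - (-1) ^+ m) *: pow_diff (r%:R + 1) m).[k.+1%:R]].
Proof.
move=> m_gt0; rewrite -signr_odd; case: (boolP (odd m)) => [m_odd|m_even] /=.
  rewrite expr1 opprK; exists (2%:R *: pow_diff (r%:R + 1) m).
  split=> [|->|//]; first by rewrite size_scale ?pnatr_eq0 // size_pow_diff.
  by rewrite pow_diff1 -mul_polyC mulr1.
rewrite expr0 subrr scale0r.
have m1 : m = 1%N -> False by move=> m1; rewrite m1 in m_even.
case: leqP => [_|/(exists_vanishing_poly F)[Q sizeQ Q0]].
  by exists 0; split=> // /m1.
by exists Q; split=> // k; rewrite Q0 horner0.
Qed.

(** [Q] is fixed only through its values at 1, ..., r, which leaves room to choose its size when [m]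
    is even. *)
Theorem dpbar_coords_sp m (Q : {poly F}) : (0 < m)%N ->
    (forall k : 'I_r, Q.[k.+1%:R]
       = ((1 - (-1) ^+ m) *: pow_diff (r%:R + 1) m).[k.+1%:R]) ->
  exists2 q : {ffun 'I_r -> Sh X}, unique (is_dpbar_coords b bs m) q &
    (forall k : 'I_r, eval_Sh (rho X) (q k) = Q.[k.+1%:R]) /\
    map_mx (eval_Sh (rho X)) (dpbar b bs m)
    = m`!%:R^-1 *: \sum_(k < r) Q.[k.+1%:R] *: vsval (sharp (fund_weight X k)).
Proof.
move=> m_gt0 QE.
apply: (dpbar_coords_rho hb sp_bracket diag_sp_rho sp_rho_inj sp_pos_rootsP
  sp_pos_roots_total sp_rhoE coroot_sp psum_sp_coroot sp_psum_inj) => k.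
by rewrite QE; apply: sp_coroot_pow_sum.
Qed.

End Symplectic.

(** * Both types over the complex numbers *)

Theorem theorem1p5 (R : realType) (t : lie_type) (r : nat) (hr : (0 < r)%N)
    (m : nat) (hm : (0 < m)%N)
    (b bs : (\dim (lie_alg (realization_of R[i] r t))).-tuple
              'M[R[i]]_(rep_dim (realization_of R[i] r t)))
    (hb : dual_bases b bs) :
  exists2 q : {ffun 'I_r -> Sh (realization_of R[i] r t)},
    unique (is_dpbar_coords b bs m) q &
    exists Q : {poly R[i]},
      [/\ if [&& is_SP t, ~~ odd m & (m <= r)%N] then Q = 0
          else size Q = m,
          forall k : 'I_r,
            eval_Sh (rho (realization_of R[i] r t)) (q k) = Q.[k.+1%:R],
          map_mx (eval_Sh (rho (realization_of R[i] r t))) (dpbar b bs m)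
          = m`!%:R^-1 *:
            \sum_(k < r) Q.[k.+1%:R] *: vsval (sharp (fund_weight (realization_of R[i] r t) k)) &
          m = 1%N -> Q = if is_SP t then 2%:R%:P else 1].
Proof.
case: t b bs hb => /= b bs hb.
  have [q q_coords [q_rho dp_rho]] := dpbar_coords_sl hb m; exists q => //.
  exists (pow_diff (r%:R / 2%:R + 1) m); split=> //; first exact: size_pow_diff.
  by move=> ->; apply: pow_diff1.
have [Q [Q_size Q1 QE]] := @sp_interpolation R[i] r m hm.
by have [q q_coords [q_rho dp_rho]] := dpbar_coords_sp hb hm QE;
  exists q => //; exists Q.
Qed.
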